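(* For every $\varepsilon\in(0,1)$, there exists $k_0=k_0(\varepsilon)\in\mathbb{N}$ such that $$R(k,k)>(1-\varepsilon)\,\Bigl(\frac{\sqrt2}{e}\Bigr)\,k\,2^{k/2},\qquad \text{for all integers } k\ge k_0.$$
   Context: For an integer $k\ge 2$, the diagonal Ramsey number $R(k,k)$ is the smallest integer $n\ge 2$ such that every $2$-coloring of the edges of the complete graph $K_n$ contains a monochromatic copy of $K_k$. $e$ is the base of the natural logarithm. *)

(* Defs.v *)
From mathcomp Require Import all_boot.

Set Implicit Arguments.
Unset Strict Implicit.
Unset Printing Implicit Defensive.

Definition Kedge (n : nat) := {e : {set 'I_n} | #|e| == 2}.

Definition coloring (n : nat) := {ffun Kedge n -> bool}.

Definition mono_clique (n : nat) (c : coloring n) (A : {set 'I_n}) : bool :=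
  [exists b : bool, [forall e : Kedge n, (val e \subset A) ==> (c e == b)]].

Definition ramsey_good (k n : nat) : bool :=
  [forall c : coloring n,
     exists A : {set 'I_n}, (#|A| == k) && mono_clique c A].

Lemma ramsey_finite (s t : nat) :
  exists N, forall (n : nat) (f : {set 'I_n} -> bool) (U : {set 'I_n}),
    N <= #|U| ->
    (exists2 A : {set 'I_n}, (A \subset U) && (#|A| == s) &
       forall e : {set 'I_n}, #|e| = 2 -> e \subset A -> f e = true) \/
    (exists2 A : {set 'I_n}, (A \subset U) && (#|A| == t) &
       forall e : {set 'I_n}, #|e| = 2 -> e \subset A -> f e = false).
Proof.
have extend n (f : {set 'I_n} -> bool) b x (A : {set 'I_n}) :
    (forall y, y \in A -> f [set x; y] = b) ->
    (forall e : {set 'I_n}, #|e| = 2 -> e \subset A -> f e = b) ->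
    forall e : {set 'I_n}, #|e| = 2 -> e \subset x |: A -> f e = b.
  move=> fx fA e e2 eA; have [xe | xNe] := boolP (x \in e); last first.
    apply: fA => //; apply/subsetP => y ye.
    have /setU1P[yx|//] := subsetP eA y ye.
    by rewrite -yx ye in xNe.
  have /cards1P[y ey] : #|e :\ x| == 1.
    by move/eqP: e2; rewrite (cardsD1 x) xe.
  have : y \in e :\ x by rewrite ey set11.
  rewrite !inE => /andP[yx ye]; rewrite -(setD1K xe) ey; apply: fx.
  by have := subsetP eA y ye; rewrite !inE (negPf yx).
elim: s t => [|s IHs] t.
  exists 0 => n f U _; left; exists set0; first by rewrite sub0set cards0.
  by move=> e e2; rewrite subset0 => /eqP e0; rewrite e0 cards0 in e2.
elim: t => [|t [N2 IHt]].
  exists 0 => n f U _; right; exists set0; first by rewrite sub0set cards0.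
  by move=> e e2; rewrite subset0 => /eqP e0; rewrite e0 cards0 in e2.
have [N1 {}IHs] := IHs t.+1.
exists (N1 + N2).+1 => n f U leU.
have /card_gt0P[x xU] : 0 < #|U| by apply: leq_trans leU.
pose B (b : bool) := [set y in U :\ x | f [set x; y] == b].
have BU b : B b \subset U.
  by apply/subsetP => y; rewrite !inE => /andP[/andP[_ ->]].
have xB b : x \notin B b by rewrite !inE eqxx.
have Bx b y : y \in B b -> f [set x; y] = b by rewrite inE => /andP[_ /eqP].
have grow b (A : {set 'I_n}) m : (A \subset B b) && (#|A| == m) ->
    (x |: A \subset U) && (#|x |: A| == m.+1).
  case/andP=> AB /eqP <-; rewrite subUset sub1set xU (subset_trans AB) //=.
  by rewrite cardsU1 (contra (subsetP AB x)).
have shrink b (A : {set 'I_n}) m : (A \subset B b) && (#|A| == m) ->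
    (A \subset U) && (#|A| == m).
  by case/andP=> AB ->; rewrite (subset_trans AB).
have cardB : N1 + N2 <= #|B true| + #|B false|.
  have -> : #|B true| + #|B false| = #|U :\ x|.
    rewrite -(cardsID [set y | f [set x; y]] (U :\ x)).
    by congr (_ + _); apply: eq_card => y; rewrite !inE; case: (f _);
       rewrite ?andbT ?andbF.
  by move: leU; rewrite (cardsD1 x) xU.
have [leT | ltT] := leqP N1 #|B true|.
  case: (IHs n f _ leT) => -[A /[dup] AB /andP[AB' _] Af].
    left; exists (x |: A); first exact: grow AB.
    by apply: extend => // y yA; apply/Bx/(subsetP AB').
  by right; exists A => //; apply: shrink AB.
have leF : N2 <= #|B false|.
  by rewrite leqNgt; apply: contraL cardB => ltF; rewrite -ltnNge -addSn leq_add // ltnW.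
case: (IHt n f _ leF) => -[A /[dup] AB /andP[AB' _] Af].
  by left; exists A => //; apply: shrink AB.
right; exists (x |: A); first exact: grow AB.
by apply: extend => // y yA; apply/Bx/(subsetP AB').
Qed.

Lemma ramsey_good_ex (k : nat) : exists n, (1 < n) && ramsey_good k n.
Proof.
have [N ramN] := ramsey_finite k k; exists (maxn 2 N).
rewrite leq_maxl; apply/forallP => c.
pose f e := if insub e is Some e' then c e' else true.
have fc (e : Kedge _) : f (val e) = c e by rewrite /f valK.
have [||] := ramN _ f setT; first by rewrite cardsT card_ord leq_maxr.
- case=> A /andP[_ cA] Af; apply/existsP; exists A; rewrite cA.
  apply/existsP; exists true; apply/forallP => e; apply/implyP => eA.
  by rewrite -fc Af //; apply/eqP/(valP e).
- case=> A /andP[_ cA] Af; apply/existsP; exists A; rewrite cA.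
  apply/existsP; exists false; apply/forallP => e; apply/implyP => eA.
  by rewrite -fc Af //; apply/eqP/(valP e).
Qed.

(* The bound 1 < n only matters for k < 2, where diag_ramsey k = 2. *)
Definition diag_ramsey (k : nat) : nat := ex_minn (ramsey_good_ex k).

(* Main.v *)
(** The colouring is found by Rosenfeld's counting form of the symmetric local
    lemma, applied to the hypergraph whose vertices are the edges of [K_n] and
    whose hyperedges are the edge sets of its [k]-cliques. If every hyperedge
    has [m] vertices and every vertex lies in at most [D] hyperedges, with
    [4 m D <= 2^(m-1)], then each further vertex on which monochromatic
    hyperedges are forbidden keeps at least the proportion [1 - 1/(2m)] of the
    colourings. Here [m = 'C(k, 2)] and [D <= 'C(n, k-2)].

    With [j = k-2] one has [m - 1 = (j+3)j/2], and ['C(n, j) <= (e n / j)^j], so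
    [n <= (1-eps) (sqrt 2 / e) k 2^(k/2)] gives [D <= e^2 (1-eps)^j 2^(m-1)];
    the factor [(1-eps)^j] beats the polynomial factor [4 m]. *)

Require Import Defs.
From mathcomp Require Import all_boot all_order all_algebra.
From mathcomp Require Import all_classical all_reals all_analysis.
From mathcomp Require Import fintype finset ring lra zify.

Set Implicit Arguments.
Unset Strict Implicit.
Unset Printing Implicit Defensive.

Import Order.TTheory GRing.Theory Num.Theory.
Local Open Scope ring_scope.

(** * Counting the 2-colourings of a sparse hypergraph *)

Definition monochromatic (T : finType) (c : {ffun T -> bool}) (A : {set T}) :=
  [exists b, [forall e in A, c e == b]].

(** Colourings of all of [T] are counted, so that the counts for different [X] compare without
    normalisation; [X] only selects the constrained hyperedges. *)
Definition avoiding (T : finType) (H : {set {set T}}) (X : {set T}) :=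
  [set c : {ffun T -> bool} |
    [forall A in H, (A \subset X) ==> ~~ monochromatic c A]].

Lemma eq_in_avoiding (T : finType) (H : {set {set T}}) (X : {set T})
    (c c' : {ffun T -> bool}) :
  {in X, c =1 c'} -> (c \in avoiding H X) = (c' \in avoiding H X).
Proof.
move=> cc'; rewrite !inE; apply: eq_forallb => A; congr (_ ==> _).
case: (boolP (A \subset X)) => //= /subsetP AX; congr (~~ _).
apply: eq_existsb => b; apply: eq_forallb => e.
by case: (boolP (e \in A)) => //= /AX /cc' ->.
Qed.

Lemma avoiding_sub (T : finType) (H : {set {set T}}) (X Y : {set T}) :
  X \subset Y -> avoiding H Y \subset avoiding H X.
Proof.
move=> XY; apply/subsetP => c; rewrite !inE => /forall_inP cY.
apply/forall_inP => A AH; apply/implyP => AX.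
exact: (implyP (cY A AH)) (subset_trans AX XY).
Qed.

(* Recolouring [A] arbitrarily preserves avoidance on [X :\: A], so at most
   the proportion [2 / 2 ^ #|A|] of these colourings is constant on [A]. *)
Lemma card_avoiding_monochromatic (T : finType) (H : {set {set T}})
    (X A : {set T}) :
  (#|[set c in avoiding H (X :\: A) | monochromatic c A]| * 2 ^ #|A|
     <= 2 * #|avoiding H (X :\: A)|)%N.
Proof.
set G := avoiding _ _.
pose M b := [set c in G | [forall e in A, c e == b]].
have cardM b : (#|M b| * 2 ^ #|A| <= #|G|)%N.
  rewrite -card_powerset -cardsX.
  (* Flip the colours of [c] on [B]: as [c] has the known colour [b] on [A], the result determines
     [B], and then [c]. *)
  pose f (p : {ffun T -> bool} * {set T}) : {ffun T -> bool} :=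
    [ffun e => p.1 e (+) (e \in p.2)].
  have f_inj : {in setX (M b) (powerset A) &, injective f}.
    move=> [c B] [c' B']; rewrite !inE /=.
    move=> /andP[/andP[_ /forall_inP cb] BA] /andP[/andP[_ /forall_inP cb'] BA'].
    move=> /ffunP fE.
    have BB' : B = B'.
      apply/setP => e; have := fE e; rewrite !ffunE /=.
      case: (boolP (e \in A)) => eA.
        by rewrite (eqP (cb e eA)) (eqP (cb' e eA)) => /addbI.
      by rewrite (contraNF (subsetP BA e)) // (contraNF (subsetP BA' e)).
    congr (_, _) => //; apply/ffunP => e.
    by have := fE e; rewrite !ffunE /= BB' => /addIb.
  rewrite -(card_in_imset f_inj); apply/subset_leq_card/subsetP => r /imsetP[[c B]].
  rewrite in_setX inE powersetE /= => /andP[/andP[cG _] BA] -> {r}.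
  rewrite -(@eq_in_avoiding _ _ _ c) // => e; rewrite inE ffunE /= => /andP[eA _].
  by rewrite (contraNF (subsetP BA e)) // addbF.
apply: leq_trans (_ : (#|M true| + #|M false|) * 2 ^ #|A| <= _)%N; last first.
  by rewrite mulnDl mul2n -addnn leq_add.
rewrite leq_mul2r; apply/orP; right.
apply: leq_trans (leq_card_setU _ _).
apply/subset_leq_card/subsetP => c; rewrite !inE => /andP[-> /existsP[[]] ->] //.
by rewrite orbT.
Qed.

Lemma bernoulli_ineq (K : realDomainType) (x : K) n :
  0 <= x <= 1 -> 1 - n%:R * x <= (1 - x) ^+ n.
Proof.
move=> /andP[x0 x1]; elim: n => [|n IH]; first by rewrite expr0; lra.
rewrite exprS; apply: le_trans (ler_wpM2l _ IH); last by lra.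
have : 0 <= n%:R :> K by [].
by rewrite -natr1; nra.
Qed.

(* By induction on [X]: a colouring lost when [e] is added is monochromatic on
   some hyperedge [A] through [e], and the induction hypothesis along
   [A :\ e] compares [avoiding H (X :\: A)] with [avoiding H X]. *)
Lemma avoiding_setU1 (T : finType) (H : {set {set T}}) (m D : nat) :
  (0 < m)%N -> {in H, forall A : {set T}, #|A| = m} ->
  (forall e, #|[set A in H | e \in A]| <= D)%N ->
  (4 * m * D <= 2 ^ m.-1)%N ->
  forall (X : {set T}) e, e \notin X ->
    (1 - (2 * m)%:R^-1) * #|avoiding H X|%:R <= #|avoiding H (e |: X)|%:R :> rat.
Proof.
move=> m0 Hm HD mD; set q : rat := 1 - _.
have m1 : 1 <= m%:R :> rat by rewrite ler1n.
have qE : q = 1 - (2 * m%:R)^-1 by rewrite /q natrM.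
have xm : (2 * m%:R)^-1 * (2 * m%:R) = 1 :> rat by rewrite mulVf //; lra.
have x01 : 0 <= ((2 * m%:R)^-1 : rat) <= 1.
  have : 0 < (2 * m%:R)^-1 :> rat by rewrite invr_gt0; lra.
  by move=> ?; apply/andP; split; nra.
have q01 : 0 <= q <= 1 by rewrite qE; lra.
(* By Bernoulli the power is at least [1 - (m - 1) / (2 m)], so [m - 1] steps of the induction cost
   at most a factor 2. *)
have qm : 2^-1 <= q ^+ m.-1.
  rewrite qE; apply: le_trans (bernoulli_ineq _ x01).
  rewrite -subn1 natrB //; nra.
move=> X e.
have [s] := ubnP #|X|; elim: s => // s IH in X e *; rewrite ltnS => Xs eX.
(* Restore the points of [X :\: Y] one at a time; a set that still misses a point of [X] is smaller
   than [X], so [IH] applies to it. *)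
have chain (Y : {set T}) : Y \subset X ->
    q ^+ #|X :\: Y| * #|avoiding H Y|%:R <= #|avoiding H X|%:R.
  move: {2}#|X :\: Y| (erefl #|X :\: Y|) => d dE YX.
  rewrite dE; elim: d => [|d IHd] in Y YX dE *.
    move/eqP: dE; rewrite cards_eq0 setD_eq0 => XY.
    have -> : Y = X by apply/eqP; rewrite eqEsubset YX.
    by rewrite expr0 mul1r.
  have /card_gt0P[y] : (0 < #|X :\: Y|)%N by rewrite dE.
  rewrite inE => /andP[yY yX].
  have yYX : y |: Y \subset X by rewrite subUset sub1set yX.
  have YsX : (#|Y| < s)%N.
    apply: leq_trans Xs; rewrite (leq_trans _ (subset_leq_card yYX)) //.
    by rewrite cardsU1 yY.
  rewrite exprSr -mulrA; apply: le_trans (IHd _ yYX _).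
    by rewrite ler_wpM2l ?exprn_ge0 ?IH //; lra.
  move: dE; rewrite (cardsD1 y) inE yY yX => -[<-].
  by apply: eq_card => z; rewrite !inE negb_or andbA.
pose G A := [set c in avoiding H (X :\: A) | monochromatic c A].
pose He := [set A in H | e \in A].
have loss : (#|avoiding H X| <= #|avoiding H (e |: X)|
    + \sum_(A in He | A \subset e |: X) #|G A|)%N.
  apply: leq_trans (_ : #|avoiding H (e |: X) :|:
      \bigcup_(A in He | A \subset e |: X) G A| <= _)%N; last first.
    apply: leq_trans (leq_card_setU _ _) _; rewrite leq_add2l.
    elim/big_rec2: _ => [|A n B _ Bn]; first by rewrite cards0.
    by apply: leq_trans (leq_card_setU _ _) _; rewrite leq_add2l.
  apply/subset_leq_card/subsetP => c cX; rewrite in_setU.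
  case: (boolP (c \in _)) => //=; rewrite inE negb_forall_in.
  case/exists_inP => A AH; rewrite negb_imply negbK => /andP[AX cA].
  have eA : e \in A.
    apply: contraTT cX => eA; rewrite inE negb_forall_in.
    apply/exists_inP; exists A; rewrite // negb_imply negbK cA andbT.
    apply/subsetP => x xA; have := subsetP AX x xA.
    by case/setU1P => // xe; rewrite -xe xA in eA.
  apply/bigcupP; exists A; first by rewrite inE AH eA.
  by rewrite inE cA andbT (subsetP (avoiding_sub _ _)  _ cX) // subsetDl.
have Gle A : A \in He -> A \subset e |: X ->
    2 ^+ m.-1 * q ^+ m.-1 * #|G A|%:R <= #|avoiding H X|%:R.
  rewrite inE => /andP[AH eA] AX.
  (* The exponent is [m.-1] and not [m] because [e] lies in [A] but outside [X]. *)
  have dE : #|X :\: (X :\: A)| = m.-1.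
    rewrite -(Hm A AH) (cardsD1 e A) eA; apply: eq_card => x.
    rewrite !inE; case: (boolP (x \in A)) => xA; rewrite ?andbF ?andbT ?orbF //=.
      have := subsetP AX x xA; rewrite !inE.
      by case: eqP => [->|] //=; rewrite (negPf eX).
    by case: (x \in X).
  have := chain _ (subsetDl X A); rewrite dE; apply: le_trans.
  rewrite mulrAC [leLHS]mulrC ler_wpM2l ?exprn_ge0 //; first by lra.
  rewrite -natrX -natrM ler_nat mulnC.
  have := card_avoiding_monochromatic H X A.
  by rewrite (Hm A AH) -{1}(prednK m0) expnS mulnCA leq_pmul2l.
have {}Gle A : A \in He -> A \subset e |: X ->
    2 ^+ m.-1 * #|G A|%:R <= 2 * #|avoiding H X|%:R :> rat.
  move=> AH AX; have := Gle A AH AX; rewrite mulrAC.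
  have : 0 <= 2 ^+ m.-1 * #|G A|%:R :> rat by rewrite mulr_ge0 ?exprn_ge0.
  by nra.
have sum_le : 2 ^+ m.-1 * (\sum_(A in He | A \subset e |: X) #|G A|)%:R
    <= D%:R * (2 * #|avoiding H X|%:R) :> rat.
  rewrite natr_sum mulr_sumr.
  apply: le_trans (_ : \sum_(A in He) (2 * #|avoiding H X|%:R) <= _).
    rewrite big_mkcondr /=; apply: ler_sum => A AH.
    by case: ifP => [|_]; [exact: Gle | rewrite mulr_ge0].
  by rewrite sumr_const -[leLHS]mulr_natl ler_wpM2r ?mulr_ge0 ?ler_nat ?HD.
have lossR : #|avoiding H X|%:R <= #|avoiding H (e |: X)|%:R
    + (\sum_(A in He | A \subset e |: X) #|G A|)%:R :> rat.
  by rewrite -natrD ler_nat.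
have mDR : 4 * m%:R * D%:R <= 2 ^+ m.-1 :> rat.
  by rewrite -natrX -!natrM ler_nat.
have P0 : 0 < 2 ^+ m.-1 :> rat by rewrite exprn_gt0.
set S := (\sum_(_ in _ | _) _)%:R in sum_le lossR.
have a0 : 0 <= #|avoiding H X|%:R :> rat by [].
(* The assumption [4 * m * D <= 2 ^ m.-1] says exactly that [2 D / 2 ^ (m - 1)] is at most
   [1 / (2 m)]. *)
have S0 : S <= (2 * m%:R)^-1 * #|avoiding H X|%:R.
  rewrite -(ler_pM2l P0); apply: le_trans sum_le _.
  rewrite mulrA; set a := #|_|%:R; rewrite [leRHS]mulrA ler_wpM2r //.
  rewrite ler_pdivlMr; last by lra.
  by apply: le_trans mDR; nra.
by rewrite qE; lra.
Qed.

(** On the empty set every colouring is avoiding, as hyperedges are nonempty; each added vertex then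
    keeps a positive proportion. *)
Lemma sparse_hypergraph_2colorable (T : finType) (H : {set {set T}})
    (m D : nat) :
  (0 < m)%N -> {in H, forall A : {set T}, #|A| = m} ->
  (forall e, #|[set A in H | e \in A]| <= D)%N ->
  (4 * m * D <= 2 ^ m.-1)%N ->
  exists c : {ffun T -> bool}, {in H, forall A : {set T}, ~~ monochromatic c A}.
Proof.
move=> m0 Hm HD mD; have grow := avoiding_setU1 m0 Hm HD mD.
suff av_gt0 (X : {set T}) : (0 < #|avoiding H X|)%N.
  have /card_gt0P[c] := av_gt0 [set: T].
  rewrite inE => /forall_inP cH; exists c => A /cH.
  by rewrite subsetT.
have [s] := ubnP #|X|; elim: s => // s IH in X *; rewrite ltnS => Xs.
have [-> | [e eX]] := set_0Vmem X.
  apply/card_gt0P; exists [ffun=> true]; rewrite inE.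
  apply/forall_inP => A AH; rewrite subset0; apply/implyP => /eqP A0.
  by have := Hm A AH; rewrite A0 cards0 => m_eq0; rewrite -m_eq0 in m0.
have /IH : (#|X :\ e| < s)%N by apply: leq_trans Xs; rewrite [leqRHS](cardsD1 e) eX.
rewrite -!(ltr0n rat) => /(mulr_gt0 _) Xe_gt0.
rewrite -(setD1K eX); apply: lt_le_trans (grow _ _ _); last by rewrite setD11.
apply: Xe_gt0; rewrite subr_gt0 invf_lt1 ?ltr0n ?ltr1n; first by lia.
by rewrite muln_gt0.
Qed.

(** * Cliques of the complete graph as hyperedges *)

Definition clique_edges (n : nat) (A : {set 'I_n}) : {set Kedge n} :=
  [set e : Kedge n | val e \subset A].

Lemma card_clique_edges (n : nat) (A : {set 'I_n}) :
  #|clique_edges A| = 'C(#|A|, 2).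
Proof.
rewrite -cards_draws -(card_imset _ val_inj); apply: eq_card => B.
apply/imsetP/idP => [[e + ->]|]; rewrite !inE; first by move=> ->; exact: (valP e).
by case/andP=> BA B2; exists (exist _ B B2); rewrite // inE.
Qed.

Lemma monochromatic_clique_edges (n : nat) (c : coloring n) (A : {set 'I_n}) :
  monochromatic c (clique_edges A) = mono_clique c A.
Proof.
by apply: eq_existsb => b; apply: eq_forallb => e; rewrite inE.
Qed.

(** Removing [B] is injective on its supersets. With [B] an edge, this bounds the degree in the
    clique hypergraph. *)
Lemma card_supersets_le (T : finType) (B : {set T}) (k : nat) :
  (#|[set A : {set T} | (#|A| == k) && (B \subset A)]| <= 'C(#|T|, k - #|B|))%N.
Proof.
rewrite -card_draws.
have inj : {in [set A : {set T} | (#|A| == k) && (B \subset A)] &,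
    injective (fun A => A :\: B)}.
  move=> A A'; rewrite !inE => /andP[_ BA] /andP[_ BA'] AA'.
  by rewrite -(setID A B) -(setID A' B) AA' (setIidPr BA) (setIidPr BA').
rewrite -(card_in_imset inj); apply/subset_leq_card/subsetP => C /imsetP[A].
rewrite !inE => /andP[/eqP <- BA] ->.
by rewrite cardsD (setIidPr BA).
Qed.

Lemma ramsey_good_lower_bound (k n : nat) : (1 < k)%N -> ramsey_good k n ->
  (2 ^ 'C(k, 2).-1 < 4 * 'C(k, 2) * 'C(n, k - 2))%N.
Proof.
move=> k1 good; rewrite ltnNge; apply/negP => le_pow.
pose H := [set clique_edges A | A in [set A : {set 'I_n} | #|A| == k]].
have Hm : {in H, forall E : {set Kedge n}, #|E| = 'C(k, 2)}.
  by move=> E /imsetP[A]; rewrite inE => /eqP <- ->; exact: card_clique_edges.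
have HD e : (#|[set E in H | e \in E]| <= 'C(n, k - 2))%N.
  have := card_supersets_le (val e) k; rewrite (eqP (valP e)) card_ord.
  apply: leq_trans.
  apply: leq_trans (leq_imset_card (@clique_edges n) _).
  apply/subset_leq_card/subsetP => E; rewrite inE => /andP[/imsetP[A Ak ->] eA].
  by apply: imset_f; move: Ak eA; rewrite !inE => ->.
have m0 : (0 < 'C(k, 2))%N by rewrite bin_gt0.
have [c cH] := sparse_hypergraph_2colorable m0 Hm HD le_pow.
have /existsP[A /andP[Ak cA]] := forallP good c.
have := cH (clique_edges A); rewrite monochromatic_clique_edges cA.
by move=> /(_ _)/negP; apply=> //; apply: imset_f; rewrite inE.
Qed.

(** * Exponential estimates *)

Lemma exprn_le_fact_expR (R : realType) (j : nat) :
  j%:R ^+ j <= j`!%:R * expR 1 ^+ j :> R.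
Proof.
elim: j => [|j IH]; first by rewrite !expr0 mulr1.
(* The ratio of consecutive values of [j ^ j / j!] is [(1 + 1/j) ^ j], at most [e]; for [j = 0] the
   convention [0 ^ 0 = 1] is used. *)
have step : j.+1%:R ^+ j <= expR 1 * j%:R ^+ j :> R.
  case: j {IH} => [|j]; first by rewrite !expr0 mulr1 ltW ?expR_gt1.
  have j0 : 0 < j.+1%:R :> R by rewrite ltr0n.
  have -> : j.+2%:R = j.+1%:R * (1 + j.+1%:R^-1) :> R.
    by rewrite mulrDr mulr1 divff ?gt_eqF // natr1.
  rewrite exprMn mulrC ler_wpM2r ?exprn_ge0 //.
  have -> : expR 1 = expR j.+1%:R^-1 ^+ j.+1 :> R.
    by rewrite -expRM_natl divff ?gt_eqF.
  by rewrite lerXn2r ?nnegrE ?addr_ge0 ?expR_ge0 ?invr_ge0 ?expR_ge1Dx.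
rewrite exprS factS natrM [expR 1 ^+ _]exprS -mulrA ler_wpM2l //.
apply: le_trans step _; rewrite mulrCA ler_wpM2l ?expR_ge0 //.
Qed.

Lemma bin_mul_exprn_le (R : realType) (n j : nat) :
  'C(n, j)%:R * j%:R ^+ j <= (n%:R * expR 1) ^+ j :> R.
Proof.
apply: le_trans (_ : 'C(n, j)%:R * (j`!%:R * expR 1 ^+ j) <= _).
  by rewrite ler_wpM2l ?exprn_le_fact_expR.
rewrite mulrA exprMn ler_wpM2r ?exprn_ge0 ?expR_ge0 //.
rewrite -natrM bin_ffact -natrX ler_nat.
elim: j => [|j IH]; first by rewrite ffactn0.
by rewrite ffactnSr expnSr leq_mul ?leq_subr.
Qed.

(** With [y = j eps], [(1 - eps) ^ j <= exp (- y)] and [exp y >= (1 + y/3) ^ 3]. A cube suffices,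
    since the factor to beat is quadratic in [j]. *)
Lemma exprn_decay (R : realType) (eps : R) (j : nat) : 0 < eps < 1 ->
  (1 - eps) ^+ j * (j%:R * eps / 3) ^+ 3 <= 1.
Proof.
move=> /andP[e0 e1].
have lower : (j%:R * eps / 3) ^+ 3 <= expR (j%:R * eps).
  have -> : expR (j%:R * eps) = expR (j%:R * eps / 3) ^+ 3.
    by rewrite -expRM_natl; congr expR; field.
  rewrite lerXn2r ?nnegrE ?expR_ge0 //.
    by rewrite divr_ge0 // mulr_ge0 // ltW.
  by apply: le_trans (expR_ge1Dx _); rewrite lerDr.
have upper : (1 - eps) ^+ j <= expR (- (j%:R * eps)).
  rewrite -mulrN expRM_natl lerXn2r ?nnegrE ?expR_ge0 ?expR_ge1Dx //.
  by rewrite subr_ge0 ltW.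
apply: le_trans (_ : expR (- (j%:R * eps)) * expR (j%:R * eps) <= _).
  apply: ler_pM => //; first by rewrite exprn_ge0 // subr_ge0 ltW.
  by rewrite exprn_ge0 // divr_ge0 // mulr_ge0 // ltW.
by rewrite -expRD addNr expR0.
Qed.

Lemma exprn_add2_le (R : realType) (j : nat) : (0 < j)%N ->
  (j + 2)%:R ^+ j <= expR 2 * j%:R ^+ j :> R.
Proof.
move=> j0; have jR : j%:R != 0 :> R by rewrite pnatr_eq0 -lt0n.
have -> : (j + 2)%:R = j%:R * (1 + 2 / j%:R) :> R by rewrite natrD; field.
rewrite exprMn mulrC ler_wpM2r ?exprn_ge0 //.
have -> : expR 2 = expR (2 / j%:R) ^+ j :> R.
  by rewrite -expRM_natl mulrC divfK.
by rewrite lerXn2r ?nnegrE ?addr_ge0 ?divr_ge0 ?expR_ge0 ?expR_ge1Dx.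
Qed.

Lemma sqrt2_powR (R : realType) (k : nat) :
  2 `^ (k%:R / 2) = Num.sqrt 2 ^+ k :> R.
Proof. by rewrite mulrC powRrM powR12_sqrt // powR_mulrn ?sqrtr_ge0. Qed.

(** * Comparison of the bounds for large [k] *)

Theorem proposition1 (R : realType) (eps : R) (heps : 0 < eps < 1) :
  exists k0 : nat, forall k : nat, (k0 <= k)%N ->
    (diag_ramsey k)%:R >
      (1 - eps) * (Num.sqrt 2 / expR 1) * k%:R * 2 `^ (k%:R / 2).
Proof.
have /andP[e0 e1] := heps.
(* Here [216 = 8 * 27]: the 8 comes from [4 m <= 8 j ^ 2], the 27 from the cube of [j eps / 3]. The
   shift by 4 ensures [j >= 2]. *)
exists (Num.trunc (216 * expR 2 / eps ^+ 3)).+4 => k.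
set t := Num.trunc _ => kt.
have [j kE] : exists j, k = (j + 2)%N by exists (k - 2)%N; lia.
have tj : (t < j)%N by lia.
have j2 : (2 <= j)%N by lia.
have {t kt tj} big_j : 216 * expR 2 < j%:R * eps ^+ 3.
  rewrite -ltr_pdivrMr ?exprn_gt0 //.
  by rewrite -truncn_lt_nat // divr_ge0 ?mulr_ge0 ?expR_ge0 ?exprn_ge0 // ltW.
rewrite /diag_ramsey; case: ex_minnP => N /andP[_ good] _.
rewrite ltNge; apply/negP; rewrite sqrt2_powR => Nle.
have := ramsey_good_lower_bound (_ : 1 < k)%N good.
rewrite {1}kE addn2 => /(_ isT); rewrite -(ltr_nat R) => Nlow.
set m := 'C(k, 2) in Nlow; set P : R := (2 ^ m.-1)%:R in Nlow.
have m2 : (m * 2 = (j + 2) * j.+1)%N.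
  by rewrite /m kE addn2 mulnC -mul_bin_diag bin1.
have s2 : Num.sqrt 2 ^+ ((j + 3) * j) = P.
  have -> : ((j + 3) * j = 2 * m.-1)%N by nia.
  by rewrite exprM sqr_sqrtr // /P natrX.
have NeP : (N%:R * expR 1) ^+ j <= (1 - eps) ^+ j * P * k%:R ^+ j.
  rewrite -s2 exprM -!exprMn lerXn2r ?nnegrE ?mulr_ge0 ?expR_ge0 //.
    by rewrite subr_ge0 ltW.
  apply: le_trans (ler_wpM2r (expR_ge0 _) Nle) _.
  rewrite le_eqVlt; apply/orP; left; apply/eqP.
  have eN0 : expR 1 != 0 :> R by rewrite gt_eqF ?expR_gt0.
  (* The constant factor [sqrt 2] of the bound raises the exponent from [k] to [k + 1]. *)
  have -> : (j + 3 = k.+1)%N by lia.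
  by rewrite exprS; field.
have q0 : 0 <= (1 - eps) ^+ j by rewrite exprn_ge0 // subr_ge0 ltW.
have P0 : 0 < P by rewrite /P ltr0n expn_gt0.
have E0 : 0 < expR 2 :> R by exact: expR_gt0.
have CP : 'C(N, j)%:R <= (1 - eps) ^+ j * P * expR 2.
  have jj : 0 < j%:R ^+ j :> R by rewrite exprn_gt0 // ltr0n; lia.
  rewrite -(ler_pM2r jj); apply: le_trans (bin_mul_exprn_le _ _ _) _.
  apply: le_trans NeP _; rewrite -[leRHS]mulrA ler_wpM2l //.
    by rewrite mulr_ge0 // ltW.
  by rewrite kE exprn_add2_le //; lia.
(* This is [2 (j + 2) (j + 1) <= 8 j ^ 2], which fails at [j = 1]; hence [j2]. *)
have m_le : (4 * m)%:R <= 8 * j%:R ^+ 2 :> R.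
  by rewrite -natrX -natrM ler_nat; nia.
have {Nlow} : 1 < 8 * j%:R ^+ 2 * ((1 - eps) ^+ j * expR 2).
  rewrite -(ltr_pM2r P0) mul1r; apply: lt_le_trans Nlow _.
  have -> : 8 * j%:R ^+ 2 * ((1 - eps) ^+ j * expR 2) * P
    = 8 * j%:R ^+ 2 * ((1 - eps) ^+ j * P * expR 2) by ring.
  by rewrite kE addnK natrM; apply: ler_pM.
have jR : 0 < j%:R :> R by rewrite ltr0n; lia.
have decay := exprn_decay j heps.
set x := (j%:R * eps / 3) ^+ 3 in decay.
have xE : 27 * x = j%:R ^+ 2 * (j%:R * eps ^+ 3) by rewrite /x; field.
have x0 : 0 < x by rewrite exprn_gt0 // divr_gt0 // mulr_gt0.
(* Multiplied by [x], the decay bound removes [(1 - eps) ^ j]; what remains, [8 j ^ 2 e ^ 2 <= x],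
   is [big_j] up to the factor 27. *)
rewrite -(ltr_pM2r x0) mul1r ltNge => /negP; apply.
apply: le_trans (_ : 8 * j%:R ^+ 2 * expR 2 <= _).
  have -> : 8 * j%:R ^+ 2 * ((1 - eps) ^+ j * expR 2) * x
    = 8 * j%:R ^+ 2 * expR 2 * ((1 - eps) ^+ j * x) by ring.
  by rewrite ler_piMr // !mulr_ge0 // ltW.
rewrite -(ler_pM2l (_ : 0 < 27 :> R)) // xE.
have := ler_wpM2l (exprn_ge0 2 (ltW jR)) (ltW big_j).
by apply: le_trans; rewrite le_eqVlt; apply/orP; left; apply/eqP; ring.
Qed.
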